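(* Let $\mu$ and $\lambda$ be strict partitions with $\mu\subseteq\lambda$. Then the power series $GP^{(\beta)}_{\lambda/\mu}$ and $GQ^{(\beta)}_{\lambda/\mu}$ are elements of $\mathfrak{m}\mathrm{Sym}$, i.e., they are symmetric in the variables $x_1,x_2,\dots$.
   Context: $\mathfrak{m}\mathrm{Sym}$ is the $\mathbb{Z}[\beta]$-module of all symmetric power series (of possibly unbounded degree) in $\mathbb{Z}[\beta][[x_1,x_2,\dots]]$, i.e. those invariant under swapping $x_i$ and $x_{i+1}$ for all $i$. A strict partition is $\lambda=(\lambda_1>\lambda_2>\cdots>0)$ (finite, possibly empty); $\mu\subseteq\lambda$ means $\mu_i\le\lambda_i$ for all $i$ (missing parts are $0$). The shifted skew diagram is $\mathsf{SD}_{\lambda/\mu}=\{(i,i+j-1)\in\mathbb{Z}_{>0}\times\mathbb{Z}_{>0}:\mu_i<j\le\lambda_i\}$, and $|\lambda/\mu|=|\lambda|-|\mu|$. Let $\mathbb{M}=\{1'<1<2'<2<\cdots\}$, $|i'|=|i|=i$. For finite nonempty $S,T\subset\mathbb{M}$ write $S\preceq T$ if $\max S\le\min T$, and $x^S=\prod_{i\in S}x_{|i|}$. A semistandard shifted set-valued tableau $T$ of shape $\lambda/\mu$ assigns to each box of $\mathsf{SD}_{\lambda/\mu}$ a finite nonempty subset of $\mathbb{M}$ so that entries weakly increase in the sense of $\preceq$ along rows ($T(i,j)\preceq T(i,j+1)$) and columns ($T(i,j)\preceq T(i+1,j)$), no unprimed number appears twice in the same column, and no primed number appears twice in the same row. Put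 $|T|=\sum|T(i,j)|$ and $x^T=\prod x^{T(i,j)}$ over all boxes. Then $$GQ^{(\beta)}_{\lambda/\mu}=\sum_T\beta^{|T|-|\lambda/\mu|}x^T$$ over all such $T$, and $GP^{(\beta)}_{\lambda/\mu}$ is the same sum restricted to those $T$ with $T(i,i)\subset\mathbb{Z}_{>0}$ (only unprimed numbers) for every diagonal box $(i,i)\in\mathsf{SD}_{\lambda/\mu}$. *)

(* Defs.v *)
From HB Require Import structures.
From mathcomp Require Import all_boot all_order all_algebra.
From mathcomp Require Import finmap monalg.
From mathcomp Require Import all_classical.

Set Implicit Arguments.
Unset Strict Implicit.
Unset Printing Implicit Defensive.

Import Order.TTheory GRing.Theory.

Local Open Scope fset_scope.
Local Open Scope classical_set_scope.
Local Open Scope nat_scope.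

(* Variables, rows and columns are all numbered from 0: the index i stands for
   the variable x_(i+1), and the box (i, c) for the box (i+1, c+1). *)

(* Z[beta] is {poly int}, with beta = 'X.  A power series over Z[beta] in
   infinitely many variables is the family of its coefficients. *)
Definition pseries := {cmonom nat} -> {poly int}.

Definition swap_index (i j : nat) : nat :=
  if j == i then i.+1 else if j == i.+1 then i else j.

Definition swap_monom (i : nat) (m : {cmonom nat}) : {cmonom nat} :=
  [cmonom m (swap_index i j) | j in swap_index i @` finsupp m]%M.

Lemma swap_indexK i : involutive (swap_index i).
Proof.
move=> j; rewrite /swap_index.
case: (eqVneq j i) => [->|ji]; first by rewrite eqxx gtn_eqF.
case: (eqVneq j i.+1) => [->|jSi]; first by rewrite eqxx.
by rewrite (negbTE ji) (negbTE jSi).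
Qed.

Lemma swap_monomE i m j : swap_monom i m j = m (swap_index i j).
Proof.
rewrite /swap_monom cmE fsfunE; case: ifPn => // jm.
rewrite -[LHS]/0; apply/esym/fsfun_dflt; apply: contra jm => jm.
by apply/imfsetP; exists (swap_index i j) => //; rewrite swap_indexK.
Qed.

Definition mSym : set pseries :=
  [set f | forall i m, f (swap_monom i m) = f m].

Definition strict_partition (la : seq nat) : bool :=
  sorted gtn la && (0 \notin la).

Definition subpart (mu la : seq nat) : Prop :=
  forall i, nth 0 mu i <= nth 0 la i.

Definition SD (la mu : seq nat) : {fset nat * nat} :=
  seq_fset tt [seq (i, i + j) | i <- iota 0 (size la),
                                j <- index_iota (nth 0 mu i) (nth 0 la i)].

Lemma in_SD la mu i c :
  ((i, c) \in SD la mu) = (i <= c) && (nth 0 mu i <= c - i < nth 0 la i).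
Proof.
rewrite seq_fsetE; apply/allpairsPdep/idP => [[k [j [_ + [-> ->]]]]|].
  by rewrite mem_index_iota leq_addr addKn.
move=> /andP[ic /andP[h1 h2]]; exists i, (c - i); split.
- rewrite mem_iota add0n leq0n /= ltnNge; apply/negP => il.
  by rewrite nth_default in h2.
- by rewrite mem_index_iota h1.
- by rewrite subnKC.
Qed.

(* (i, false) is the primed letter (i+1)' and (i, true) the letter i+1; the
   lexicographic order is 1' < 1 < 2' < 2 < ... *)
Definition letter : Type := (nat *l bool)%type.

HB.instance Definition _ := Order.Total.on letter.

Definition primed (a : letter) : bool := ~~ a.2.

Definition x_set (S : {fset letter}) : {cmonom nat} :=
  (\big[mmul/mone]_(a <- S) ucm a.1)%M.

(* For nonempty S and T this is max S <= min T, see precsP. *)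
Definition precs (S T : {fset letter}) : Prop :=
  forall a b, a \in S -> b \in T -> (a <= b)%O.

Lemma precsP (S T : {fset letter}) (s t : letter) :
    s \in S -> (forall a, a \in S -> (a <= s)%O) ->
    t \in T -> (forall b, b \in T -> (t <= b)%O) ->
  precs S T <-> (s <= t)%O.
Proof.
move=> sS smax tT tmin; split => [|st a b aS bT]; first exact.
exact: le_trans (smax a aS) (le_trans st (tmin b bT)).
Qed.

Section Tableaux.
Variables la mu : seq nat.

Definition tableau := {ffun SD la mu -> {fset letter}}.

Record semistandard (T : tableau) : Prop := Semistandard {
  ss_nonempty : forall b, T b != fset0;
  ss_row : forall b c, val c = ((val b).1, (val b).2.+1) -> precs (T b) (T c);
  ss_col : forall b c, val c = ((val b).1.+1, (val b).2) -> precs (T b) (T c);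
  ss_unprimed : forall b c a, b != c -> (val b).2 = (val c).2 ->
    ~~ primed a -> a \in T b -> a \notin T c;
  ss_primed : forall b c a, b != c -> (val b).1 = (val c).1 ->
    primed a -> a \in T b -> a \notin T c
}.

Definition diag_unprimed (T : tableau) : Prop :=
  forall b, (val b).1 = (val b).2 -> forall a, a \in T b -> ~~ primed a.

Definition tsize (T : tableau) : nat := \sum_b #|` T b|.

Definition x_tab (T : tableau) : {cmonom nat} :=
  (\big[mmul/mone]_b x_set (T b))%M.

(* The sum, over the tableaux in A, of beta^(|T| - |la/mu|) x^T.  The sum below
   is over a finite set by finite_x_tab, and the subtraction is not truncated,
   the sets T b being nonempty. *)
Definition tab_series (A : set tableau) : pseries := fun m =>
  (\sum_(T \in [set T | A T /\ x_tab T = m])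
     ('X^(tsize T - (sumn la - sumn mu)) : {poly int}))%R.

Definition GQ : pseries := tab_series [set T | semistandard T].

Definition GP : pseries :=
  tab_series [set T | semistandard T /\ diag_unprimed T].

Lemma finite_x_tab (A : set tableau) m :
  finite_set [set T | A T /\ x_tab T = m].
Proof.
pose L : {fset letter} := seq_fset tt [seq ((i, p) : letter) |
  i <- finsupp m, p <- [:: true; false]].
pose f (g : {ffun SD la mu -> fpowerset L}) : tableau := [ffun b => val (g b)].
apply: (@sub_finite_set _ _ (f @` setT)); last first.
  exact/finite_image/finite_finset.
move=> T /= [_ Tm].
have TL b : T b \in fpowerset L.
  rewrite fpowersetE; apply/fsubsetP => -[i p] ipT.
  rewrite seq_fsetE; apply/allpairsP; exists (i, p) => /=; split => //.
    rewrite -Tm /x_tab (bigD1 b) //= -cmE_neq0 cmM /x_set.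
    by rewrite (big_fsetD1 (i, p)) //= cmM cmU eqxx.
  by case: p ipT.
exists [ffun b => FSetSub (TL b)] => //.
by apply/ffunP => b; rewrite !ffunE.
Qed.

End Tableaux.

(* Main.v *)
(** The exponent of beta is determined by the degree of the monomial, so it is
    enough to count tableaux by weight.  Order the pairs (letter, content) by
    letter, breaking ties by increasing content for unprimed letters and by
    decreasing content for primed ones.  A filling is semistandard exactly when
    all pairs carried by a box precede all pairs carried by any larger box, so
    tableaux are enumerated by reading the pairs in order and deciding each time
    whether the letter is put into the next box of that diagonal.  Let [u_c]
    fill, or refill, the next box of content [c].  Then letter [k] contributes

      K(X) = h_N(X) ... h_1(X) p(X) h_1(X) ... h_N(X),
      h_c(X) = 1 + (X - 1) u_c,

    where X = 1 + x_k and p(X) is h_0(X) for GP and h_0(X)^2 = h_0(X^2) for GQ.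
    The [u_c] are idempotent, commute at distance at least 2, and satisfy
    u_{c+1} u_c u_{c+1} = 0 and u_{c+1} u_{c+2} u_{c+1} = 0, whence the
    Yang-Baxter equation and, by induction on N, the reflection equation for K;
    for contents exceeding those of the shape the latter says K(X) K(Y) =
    K(Y) K(X). *)

Require Import Defs.
From mathcomp Require Import all_boot.
From HB Require Import structures.
From mathcomp Require Import all_order all_algebra.
From mathcomp Require Import finmap monalg ring zify.
From mathcomp Require all_classical.

Set Implicit Arguments.
Unset Strict Implicit.
Unset Printing Implicit Defensive.

Import Order.TTheory GRing.Theory.
Local Open Scope ring_scope.

(** * The reflection equation *)

Section ReflectionEquation.
Variables (R : comNzRingType) (S : finType).
Local Notation V := {ffun S -> R^o}.
Variable u : nat -> {linear V -> V}.

(* The projective form a (1 - u_i) + b u_i of h_i(b/a) avoids all divisions. *)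
Definition hop i a b (v : V) : V := a *: v + (b - a) *: u i v.

(** Turns pointwise scalings in [R^o] into products that [ring] can handle. *)
Lemma regularZ (a : R) (b : R^o) : a *: b = a * b.
Proof. by []. Qed.

Lemma hopZ i a b c v : hop i a b (c *: v) = c *: hop i a b v.
Proof.
rewrite /hop !linearZ; apply/ffunP => s; rewrite !ffunE !regularZ; ring.
Qed.

Hypothesis u_idem : forall i v, u i (u i v) = u i v.
Hypothesis u_comm : forall i j v, (i.+1 < j)%N -> u i (u j v) = u j (u i v).
Hypothesis u_up : forall i v, u i.+1 (u i (u i.+1 v)) = 0.
Hypothesis u_down : forall i v, u i.+1 (u i.+2 (u i.+1 v)) = 0.

Lemma hop_comm i j a b c d v : (i.+1 < j)%N ->
  hop i a b (hop j c d v) = hop j c d (hop i a b v).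
Proof.
move=> ij; rewrite /hop !(linearD, linearZ) /= (u_comm _ ij).
by apply/ffunP => s; rewrite !ffunE !regularZ; ring.
Qed.

(* Alternating words in [u i] and [u j], of length at most three, applied to
   [v]; the word [u j (u i (u j v))] vanishes in both cases of interest. *)
Definition words i j v c0 ci cj cij cji ciji : V :=
  c0 *: v + ci *: u i v + cj *: u j v + cij *: u i (u j v)
  + cji *: u j (u i v) + ciji *: u i (u j (u i v)).

Lemma words1 i j v : v = words i j v 1 0 0 0 0 0.
Proof. by rewrite /words scale1r !scale0r !addr0. Qed.

Lemma words_trunc i j v c0 ci cj cij cji ciji :
  (forall w, u i (u j (u i w)) = 0) ->
  words i j v c0 ci cj cij cji ciji = words i j v c0 ci cj cij cji 0.
Proof. by move=> uij; rewrite /words uij !scaler0. Qed.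

Lemma eq_words i j v c0 ci cj cij cji ciji d0 di dj dij dji diji :
  c0 = d0 -> ci = di -> cj = dj -> cij = dij -> cji = dji -> ciji = diji ->
  words i j v c0 ci cj cij cji ciji = words i j v d0 di dj dij dji diji.
Proof. by move=> -> -> -> -> -> ->. Qed.

Lemma hop_words_l i j v a b c0 ci cj cij cji ciji :
  hop i a b (words i j v c0 ci cj cij cji ciji) =
  words i j v (a * c0) (b * ci + (b - a) * c0) (a * cj)
    (b * cij + (b - a) * cj) (a * cji) (b * ciji + (b - a) * cji).
Proof.
rewrite /hop /words !linearD !linearZ /= !u_idem.
by apply/ffunP => s; rewrite !ffunE !regularZ; ring.
Qed.

Lemma hop_words_r i j v a b c0 ci cj cij cji ciji :
  (forall w, u j (u i (u j w)) = 0) ->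
  hop j a b (words i j v c0 ci cj cij cji ciji) =
  words i j v (a * c0) (a * ci) (b * cj + (b - a) * c0)
    (a * cij) (b * cji + (b - a) * ci) (a * ciji).
Proof.
move=> uji; rewrite /hop /words !linearD !linearZ /= !u_idem !uji !scaler0.
by apply/ffunP => s; rewrite !ffunE !regularZ; ring.
Qed.

(** The condition says that the middle ratio [f / e] is the product of the outer ratios [b / a] and
    [d / c]. Both three-letter words vanish, the two-letter words have equal coefficients, and those
    of [u i.+1 v] and [u i.+2 v] agree by the condition. *)
Lemma yang_baxter i a b c d e f v : e * (b * d) = f * (a * c) ->
  hop i.+1 a b (hop i.+2 e f (hop i.+1 c d v)) =
  hop i.+2 c d (hop i.+1 e f (hop i.+2 a b v)).
Proof.
move=> /eqP; rewrite -subr_eq0 => /eqP E.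
rewrite [v](words1 i.+1 i.+2) !(hop_words_l, hop_words_r) //.
rewrite [LHS]words_trunc // [RHS]words_trunc //.
apply: eq_words; try ring; apply: subr0_eq; first by rewrite -[RHS]E; ring.
by rewrite -[RHS]oppr0 -[in RHS]E; ring.
Qed.

(* Equivalent to the reflection equation at the boundary, by comparing the
   coefficients of [u 0 (u 1 v)] and of [u 1 (u 0 v)]. *)
Variable p : R -> R.
Hypothesis p_rel : forall X Y,
  (X * Y - 1) * X * (p X - p Y) =
  (X - Y) * ((p X - 1) * X * Y + (p Y - 1) * p X).

Lemma reflection0 X Y v :
  hop 0 1 (p X) (hop 1 1 (X * Y) (hop 0 1 (p Y) (hop 1 X Y v))) =
  hop 1 X Y (hop 0 1 (p Y) (hop 1 1 (X * Y) (hop 0 1 (p X) v))).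
Proof.
rewrite [v](words1 0 1) !(hop_words_l, hop_words_r) //.
have /eqP := p_rel X Y; rewrite -subr_eq0 => /eqP E.
apply: eq_words; try ring; apply: subr0_eq; first by rewrite -[RHS]E; ring.
by rewrite -[RHS]oppr0 -[in RHS]E; ring.
Qed.

Fixpoint kop n X (v : V) : V :=
  if n is m.+1 then hop m.+1 1 X (kop m X (hop m.+1 1 X v))
  else hop 0 1 (p X) v.

Lemma kopZ n X c v : kop n X (c *: v) = c *: kop n X v.
Proof.
by elim: n v => [|n IH] v /=; first exact: hopZ; rewrite hopZ IH hopZ.
Qed.

Lemma kop_hop n X j a b v : (n.+1 < j)%N ->
  kop n X (hop j a b v) = hop j a b (kop n X v).
Proof.
elim: n v => [|n IH] v nj /=; first exact: hop_comm.
by rewrite (hop_comm _ _ _ _ _ nj) (IH _ (ltnW nj)) (hop_comm _ _ _ _ _ nj).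
Qed.

Lemma reflection n X Y v :
  kop n X (hop n.+1 1 (X * Y) (kop n Y (hop n.+1 X Y v))) =
  hop n.+1 X Y (kop n Y (hop n.+1 1 (X * Y) (kop n X v))).
Proof.
elim: n v => [|n IH] v /=; first exact: reflection0.
have far Z a b w : kop n Z (hop n.+2 a b w) = hop n.+2 a b (kop n Z w).
  exact: kop_hop.
(* Yang-Baxter turns outer [hop n.+1] factors into [hop n.+2] factors, which pass through [kop n].
   Once the equation for [n] stands in the middle it is applied, and the same moves are undone in
   mirror image. *)
rewrite (@yang_baxter _ 1 X 1 Y); last by ring.
rewrite far -[hop n.+2 1 X _]far -(@yang_baxter _ X Y 1 X); last by ring.
rewrite IH (@yang_baxter _ 1 X X Y); last by ring.
rewrite far -[hop n.+2 1 X (kop n Y _)]far.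
by rewrite -(@yang_baxter _ 1 Y 1 X); last by ring.
Qed.

(** With [u n.+1] zero, the [hop n.+1] factors of the reflection equation become the scalars [1] and
    [X], and the regular element [X] cancels. *)
Lemma kop_comm n X Y v :
    (forall w, u n.+1 w = 0) -> (forall a, X * a = 0 -> a = 0) ->
  kop n X (kop n Y v) = kop n Y (kop n X v).
Proof.
move=> u0 Xreg; have hop0 a b w : hop n.+1 a b w = a *: w.
  by rewrite /hop u0 scaler0 addr0.
have := reflection n X Y v; rewrite !hop0 !scale1r !kopZ => /ffunP E.
apply/ffunP => s; apply/subr0_eq/Xreg; rewrite mulrBr; apply/eqP.
by rewrite subr_eq0; move: (E s); rewrite !ffunE !regularZ => ->.
Qed.

End ReflectionEquation.

(** * Adding boxes *)

Definition content (b : nat * nat) : nat := (b.2 - b.1)%N.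

Definition below (b d : nat * nat) : bool :=
  [&& b.1 <= d.1, b.2 <= d.2 & b.1 + b.2 < d.1 + d.2]%N.

Definition shifted_convex (D : {fset nat * nat}) : Prop :=
  (forall b, b \in D -> (b.1 <= b.2)%N) /\
  (forall b d e, b \in D -> e \in D -> (d.1 <= d.2)%N ->
     below b d -> below d e -> d \in D).

Section BoxOperators.
Variables (R : comNzRingType) (D : {fset nat * nat}).
Hypothesis D_convex : shifted_convex D.
Local Notation V := {ffun {set D} -> R^o}.

(* The relations between the operators hold on arbitrary sets of boxes [I],
   not only on order ideals. *)
Definition addable (I : {set D}) (b : D) : bool :=
  [forall d : D, (below (val d) (val b) ==> (d \in I)) &&
                 (below (val b) (val d) ==> (d \notin I))].

(** Acting on functions of [I], this is the transpose of adding a box: in a composite, the outermost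
    operator adds its box first. A box already in [I] may be added again, whence idempotence. *)
Definition add_box (c : nat) (f : V) : V :=
  [ffun I : {set D} =>
     \sum_(b | (content (val b) == c) && addable I b) f (b |: I)].

Lemma add_box_linear c : linear (add_box c).
Proof.
move=> a f g; apply/ffunP => I; rewrite !ffunE scaler_sumr -big_split /=.
by apply: eq_bigr => b _; rewrite !ffunE.
Qed.

HB.instance Definition _ c :=
  GRing.isLinear.Build R V V *:%R (add_box c) (add_box_linear c).

Lemma addable_lo I b d : addable I b -> below (val d) (val b) -> d \in I.
Proof. by move=> /forallP/(_ d)/andP[/implyP + _]. Qed.

Lemma addable_hi I b d : addable I b -> below (val b) (val d) -> d \notin I.
Proof. by move=> /forallP/(_ d)/andP[_ /implyP]. Qed.

Lemma belowxx b : below b b = false.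
Proof. by rewrite /below; lia. Qed.

Lemma addable_setU1 I b : addable I b -> addable (b |: I) b.
Proof.
move=> ok; apply/forallP => d; rewrite !inE.
case: eqVneq => [->|_] /=; first by rewrite belowxx.
by move/forallP: ok => /(_ d).
Qed.

Lemma diag_le (b : D) : ((val b).1 <= (val b).2)%N.
Proof. by case: D_convex => + _; apply; exact: valP. Qed.

(** Of two incomparable boxes one has the smaller row and the larger column, so their contents
    differ by at least 2. *)
Lemma content_cmp (b d : D) : (content (val b) <= (content (val d)).+1)%N ->
  (content (val d) <= (content (val b)).+1)%N ->
  [|| b == d, below (val b) (val d) | below (val d) (val b)].
Proof.
have := diag_le b; have := diag_le d; rewrite -val_eqE /content /below.
case: b d => [[b1 b2] bD] [[d1 d2] dD] /=; rewrite xpair_eqE; lia.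
Qed.

Lemma between (b d : D) : content (val b) = content (val d) ->
  below (val b) (val d) ->
  exists2 e : D, content (val e) = (content (val b)).+1 &
    below (val b) (val e) && below (val e) (val d).
Proof.
have := diag_le b; have := diag_le d; case: D_convex => _ conv.
case: b d => [[b1 b2] bD] [[d1 d2] dD] /= db bb.
rewrite /content /= => cbd bd.
have [h1 h2] : below (b1, b2) (b1, b2.+1) /\ below (b1, b2.+1) (d1, d2).
  by move: bd; rewrite /below /=; lia.
have eD : (b1, b2.+1) \in D.
  by apply: conv bD dD _ h1 h2 => /=; lia.
by exists [` eD]%fset => /=; rewrite ?h1 ?h2 //; lia.
Qed.

(** The witness is the box just under [b], which leaves the shifted region when [b] is on the main
    diagonal. This is why [u 0 (u 1 (u 0 v))] may survive. *)
Lemma between_lo (b d : D) : content (val b) = content (val d) ->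
  (0 < content (val b))%N -> below (val b) (val d) ->
  exists2 e : D, content (val e) = (content (val b)).-1 &
    below (val b) (val e) && below (val e) (val d).
Proof.
have := diag_le b; have := diag_le d; case: D_convex => _ conv.
case: b d => [[b1 b2] bD] [[d1 d2] dD] /= db bb.
rewrite /content /= => cbd c0 bd.
have [h1 h2] : below (b1, b2) (b1.+1, b2) /\ below (b1.+1, b2) (d1, d2).
  by move: bd; rewrite /below /=; lia.
have eD : (b1.+1, b2) \in D.
  by apply: conv bD dD _ h1 h2 => /=; lia.
by exists [` eD]%fset => /=; rewrite ?h1 ?h2 //; lia.
Qed.

Lemma between_far (b d : D) : below (val b) (val d) ->
    ((content (val b)).+1 < content (val d))%N ||
    ((content (val d)).+1 < content (val b))%N ->
  exists e : D, below (val b) (val e) && below (val e) (val d).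
Proof.
have := diag_le b; have := diag_le d; case: D_convex => _ conv.
case: b d => [[b1 b2] bD] [[d1 d2] dD] /= db bb bd.
have wit e : (e.1 <= e.2)%N -> below (b1, b2) e && below e (d1, d2) ->
    exists e : D, below (b1, b2) (val e) && below (val e) (d1, d2).
  move=> ee /andP[be ed]; have eD := conv _ _ _ bD dD ee be ed.
  by exists [` eD]%fset; rewrite be ed.
rewrite /content /= => /orP[]; move: bd; rewrite /below /= => bd lt.
  by apply: (wit (b1, b2.+1)); rewrite /below /=; lia.
by apply: (wit (b1.+1, b2)); rewrite /below /=; lia.
Qed.

(** A box between two addable boxes would be both outside and inside [I]. Hence the sum in [add_box]
    has at most one term. *)
Lemma addable_inj I b d : content (val b) = content (val d) ->
  addable I b -> addable I d -> b = d.
Proof.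
move=> cbd okb okd; have := @content_cmp b d; rewrite cbd leqnSn.
case/(_ isT isT)/or3P => [/eqP//|bd|db].
- have [e _ /andP[be ed]] := between cbd bd.
  by have := addable_hi okb be; rewrite (addable_lo okd ed).
- have [e _ /andP[be ed]] := between (esym cbd) db.
  by have := addable_hi okd be; rewrite (addable_lo okb ed).
Qed.

Lemma add_box_idem c f : add_box c (add_box c f) = add_box c f.
Proof.
apply/ffunP => I; rewrite !ffunE; apply: eq_bigr => b /andP[/eqP cb ok].
have ok' := addable_setU1 ok.
rewrite ffunE (big_pred1 b) => [|d]; first by rewrite setUA setUid.
apply/andP/eqP => [[/eqP cd okd]|->]; last by rewrite cb eqxx.
by apply: addable_inj ok'; rewrite ?cb.
Qed.

(* Three boxes added in succession form a chain b1 < b2 < b3; a box strictly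
   between b1 and b3, of content other than [c'], would have to be both absent
   when b1 is added and present when b3 is. *)
Lemma add_box_chain c c' f (e_of : forall b d : D, content (val b) = c ->
    content (val d) = c -> below (val b) (val d) ->
    exists2 e : D, content (val e) != c' &
      below (val b) (val e) && below (val e) (val d)) :
  (c <= c'.+1)%N -> (c' <= c.+1)%N -> c != c' ->
  add_box c (add_box c' (add_box c f)) = 0.
Proof.
move=> cc' c'c neq; apply/ffunP => I; rewrite !ffunE big1 // => b1 /andP[/eqP cb1 ok1].
rewrite ffunE big1 // => b2 /andP[/eqP cb2 ok2].
rewrite ffunE big_pred0 // => b3; apply/negP => /andP[/eqP cb3 ok3].
have lt12 : below (val b1) (val b2).
  have := @content_cmp b1 b2; rewrite cb1 cb2 => /(_ cc' c'c).
  case/or3P => // [/eqP b12|lt21]; first by rewrite -cb1 -cb2 b12 eqxx in neq.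
  by have := addable_hi ok2 lt21; rewrite !inE eqxx.
have lt23 : below (val b2) (val b3).
  have := @content_cmp b2 b3; rewrite cb3 cb2 => /(_ c'c cc').
  case/or3P => // [/eqP b12|lt21]; first by rewrite -cb3 -cb2 b12 eqxx in neq.
  by have := addable_hi ok3 lt21; rewrite !inE eqxx.
have lt13 : below (val b1) (val b3) by move: lt12 lt23; rewrite /below; lia.
have [e ce /andP[lt1e lte3]] := e_of _ _ cb1 cb3 lt13.
have := addable_lo ok3 lte3; rewrite !inE (negbTE (addable_hi ok1 lt1e)) orbF.
case/orP => /eqP E; first by rewrite -cb2 E eqxx in ce.
by rewrite E belowxx in lt1e.
Qed.

Lemma add_box_up c f : add_box c.+1 (add_box c (add_box c.+1 f)) = 0.
Proof.
apply: add_box_chain => [b d cb cd bd|||]; try lia.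
have [|e ce be] := @between b d _ bd; first by rewrite cb.
by exists e => //; rewrite ce cb; lia.
Qed.

Lemma add_box_down c f : add_box c.+1 (add_box c.+2 (add_box c.+1 f)) = 0.
Proof.
apply: add_box_chain => [b d cb cd bd|||]; try lia.
have [||e ce be] := @between_lo b d _ _ bd; rewrite ?cb //.
by exists e => //; rewrite ce cb; lia.
Qed.

(** The boxes are incomparable: if [b] were below [d], a box between them would be absent when [b]
    is added and present when [d] is; if [d] were below [b], it would come too late. *)
Lemma addable_far I b d :
    ((content (val b)).+1 < content (val d))%N ||
    ((content (val d)).+1 < content (val b))%N ->
  addable I b -> addable (b |: I) d -> addable I d && addable (d |: I) b.
Proof.
move=> far okb okd.
have nbd : ~~ below (val b) (val d).
  apply/negP => bd; have [e /andP[be ed]] := between_far bd far.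
  have := addable_lo okd ed; rewrite !inE (negbTE (addable_hi okb be)) orbF.
  by move/eqP=> E; rewrite E belowxx in be.
have ndb : ~~ below (val d) (val b).
  by apply/negP => db; have := addable_hi okd db; rewrite !inE eqxx.
apply/andP; split; apply/forallP => e.
  move/forallP/(_ e): okd; rewrite !inE.
  by case: (eqVneq e b) => [->|//]; rewrite (negbTE nbd) (negbTE ndb).
move/forallP/(_ e): okb; rewrite !inE.
by case: (eqVneq e d) => [->|//]; rewrite (negbTE nbd) (negbTE ndb).
Qed.

Lemma add_box_comm c c' f : (c.+1 < c')%N ->
  add_box c (add_box c' f) = add_box c' (add_box c f).
Proof.
move=> cc'; apply/ffunP => I; rewrite !ffunE.
under eq_bigr do rewrite ffunE; under [RHS]eq_bigr do rewrite ffunE.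
rewrite (exchange_big_dep (fun b => content (val b) == c')) /=; last first.
  by move=> b d _ /andP[].
rewrite [RHS](big_mkcondr) /=; apply: eq_bigr => d /eqP cd.
have far (b : D) : content (val b) = c ->
    ((content (val b)).+1 < content (val d))%N ||
    ((content (val d)).+1 < content (val b))%N by rewrite cd => ->; rewrite cc'.
case: ifPn => okd; last first.
  rewrite big_pred0 // => b; apply/negP.
  case/andP => /andP[/eqP cb okb] /andP[_ okdb].
  by have /andP[okd' _] := addable_far (far b cb) okb okdb; rewrite okd' in okd.
apply: eq_big => [b|b _]; last by rewrite setUCA.
rewrite cd eqxx andTb -andbA; case: eqP => //= cb.
apply/andP/idP => [[okb okdb]|okbd].
  by have /andP[] := addable_far (far b cb) okb okdb.
have farC := far b cb; rewrite orbC in farC.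
by have /andP[] := addable_far farC okd okbd.
Qed.

End BoxOperators.

(** * Summing over fillings *)

Section PartitionSum.
Variables (R : comNzRingType) (D : {fset nat * nat}) (A : finType).
Hypothesis D_convex : shifted_convex D.
Variables (x : A -> R) (lt : rel (A * nat)).
Hypotheses (lt_irr : irreflexive lt) (lt_trans : transitive lt).
Local Notation V := {ffun {set D} -> R^o}.
Local Notation filling := {ffun D -> {set A}}.

(** Boxes may be empty, so that prefixes of the reading word can be treated by induction; the
    condition [T b != set0] makes the occupied boxes an order ideal. *)
Definition valid (s : seq (A * nat)) (T : filling) : bool :=
  [forall b, forall a, (a \in T b) ==> ((a, content (val b)) \in s)] &&
  [forall b : D, forall d : D, below (val b) (val d) ==>
     [forall a', (a' \in T d) ==> (T b != set0) &&
       [forall a, (a \in T b) ==>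
          lt (a, content (val b)) (a', content (val d))]]].

Lemma validP (s : seq (A * nat)) (T : filling) : reflect
  ((forall (b : D) a, a \in T b -> (a, content (val b)) \in s) /\
   (forall (b d : D) a', below (val b) (val d) -> a' \in T d -> T b != set0 /\
      (forall a, a \in T b -> lt (a, content (val b)) (a', content (val d)))))
  (valid s T).
Proof.
apply: (iffP andP) => -[H1 H2]; split.
- by move=> b a; move/forallP: H1 => /(_ b)/forallP/(_ a)/implyP.
- move=> b d a' bd aT; move/forallP: H2 => /(_ b)/forallP/(_ d)/implyP/(_ bd).
  move/forallP=> /(_ a')/implyP/(_ aT)/andP[-> H]; split => // a.
  by move/forallP: H => /(_ a)/implyP.
- by apply/forallP => b; apply/forallP => a; apply/implyP/H1.
- apply/forallP => b; apply/forallP => d; apply/implyP => bd.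
  apply/forallP => a'; apply/implyP => aT; have [-> H] := H2 b d a' bd aT.
  by apply/forallP => a; apply/implyP/H.
Qed.

Definition occupied (T : filling) : {set D} := [set b | T b != set0].

Definition weight (T : filling) : R := \prod_b \prod_(a in T b) x a.

Definition put (a : A) (b : D) (T : filling) : filling :=
  [ffun d => if d == b then a |: T d else T d].
Definition cut (a : A) (b : D) (T : filling) : filling :=
  [ffun d => if d == b then T d :\ a else T d].

Lemma putE a b T d : put a b T d = if d == b then a |: T d else T d.
Proof. by rewrite ffunE. Qed.

Lemma occupied_put a b T : occupied (put a b T) = b |: occupied T.
Proof.
apply/setP => d; rewrite !inE ffunE; case: (eqVneq d b) => //= _.
by apply/set0Pn; exists a; rewrite !inE eqxx.
Qed.

Lemma weight_put a b (T : filling) :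
  a \notin T b -> weight (put a b T) = x a * weight T.
Proof.
move=> aT; rewrite /weight (bigD1 b) // [in RHS](bigD1 b) //= ffunE eqxx.
rewrite big_setU1 //= mulrA; congr (_ * _).
by apply: eq_bigr => d /negbTE db; rewrite ffunE db.
Qed.

Lemma cutK a b (T : filling) : a \in T b -> put a b (cut a b T) = T.
Proof.
move=> aT; apply/ffunP => d; rewrite !ffunE; case: eqVneq => // ->.
by rewrite setD1K.
Qed.

Lemma putK a b (T : filling) : (cut a b (put a b T) == T) = (a \notin T b).
Proof.
apply/eqP/idP => [/ffunP/(_ b)|aT]; first by rewrite !ffunE eqxx => <-; rewrite !inE eqxx.
by apply/ffunP => d; rewrite !ffunE; case: eqVneq => // ->; rewrite setU1K.
Qed.

(** * Removing the last pair of the reading word *)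

Section LastStep.
Variables (s : seq (A * nat)) (a : A) (c : nat).
Hypothesis s_lt : forall z, z \in s -> lt z (a, c).

Lemma last_max z : z \in rcons s (a, c) -> lt (a, c) z = false.
Proof.
rewrite mem_rcons inE => /orP[/eqP->|/s_lt zlt]; first exact: lt_irr.
by apply/negP => ltz; have := lt_trans ltz zlt; rewrite lt_irr.
Qed.

(** Two boxes of content [c] are comparable, so if both held [a] the pair [(a, c)] would precede
    itself. *)
Lemma valid_uniq (T : filling) b d : valid (rcons s (a, c)) T ->
  content (val b) = c -> content (val d) = c -> a \in T b -> a \in T d -> b = d.
Proof.
move=> /validP[_ H2] cb cd ab ad; have := @content_cmp _ D_convex b d.
rewrite cb cd leqnSn => /(_ isT isT)/or3P[/eqP//|bd|db].
- by have [_ /(_ a ab)] := H2 _ _ _ bd ad; rewrite cb cd lt_irr.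
- by have [_ /(_ a ad)] := H2 _ _ _ db ab; rewrite cb cd lt_irr.
Qed.

Lemma valid_unused (T : filling) :
  valid (rcons s (a, c)) T &&
    ~~ [exists b, (content (val b) == c) && (a \in T b)] = valid s T.
Proof.
apply/andP/validP => [[/validP[H1 H2] /existsPn nob]|[H1 H2]]; first split => //.
  move=> b a' aT; have := H1 b a' aT; rewrite mem_rcons inE => /orP[/eqP[E1 E2]|//].
  by have := nob b; rewrite E2 eqxx -E1 aT.
split.
  by apply/validP; split => // b a' /H1; rewrite mem_rcons inE orbC => ->.
apply/existsPn => b; apply/negP => /andP[/eqP cb /H1]; rewrite cb => /s_lt.
by rewrite lt_irr.
Qed.

(** As [(a, c)] is the largest pair, nothing can follow it: the boxes above [b] are empty, and
    validity makes those below [b] occupied. This is addability, whether or not [b] already holds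
    smaller letters. *)
Lemma valid_put (T : filling) b : content (val b) = c ->
  [&& valid (rcons s (a, c)) (put a b T), a \in put a b T b & a \notin T b] =
  valid s T && addable (occupied T) b.
Proof.
move=> cb; have -> : a \in put a b T b by rewrite putE eqxx !inE eqxx.
have neq (d e : D) : below (val d) (val e) -> d != e.
  by move=> de; apply/eqP => E; rewrite E belowxx in de.
have sub d e : e \in T d -> e \in put a b T d.
  by rewrite putE; case: ifP => // _; rewrite !inE orbC => ->.
apply/andP/andP => [[vT aT]|[/validP[H1 H2] ok]].
  have /validP[H1 H2] := vT.
  have hi d : below (val b) (val d) -> T d = set0.
    move=> bd; apply/eqP; apply: contraT => /set0Pn[a' a'T].
    have [_ /(_ a)] := H2 b d a' bd (sub _ _ a'T).
    rewrite putE eqxx !inE eqxx cb => /(_ isT).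
    by rewrite last_max // H1 // sub.
  split.
    apply/validP; split.
      move=> d a' a'T; have := H1 d a' (sub _ _ a'T).
      rewrite mem_rcons inE => /orP[/eqP[E1 E2]|//]; subst a'.
      have E : d = b.
        by apply: (valid_uniq vT) => //; [exact: sub|rewrite putE eqxx !inE eqxx].
      by rewrite E (negbTE aT) in a'T.
    move=> d e a' de a'T; have [nd H] := H2 d e a' de (sub _ _ a'T).
    split=> [|a'' /sub/H//]; move: nd; rewrite putE; case: (eqVneq d b) => // E.
    by rewrite E in de; rewrite (hi e de) inE in a'T.
  apply/forallP => d; rewrite !inE; apply/andP; split; apply/implyP => bd.
    have := H2 d b a bd; rewrite !putE eqxx !inE eqxx (negbTE (neq _ _ bd)).
    by case=> // /negbT.
  by rewrite (hi d bd) eqxx.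
have aT : a \notin T b.
  by apply/negP => /H1; rewrite cb => /s_lt; rewrite lt_irr.
split => //; apply/validP; split.
  move=> d a'; rewrite putE mem_rcons inE; case: eqVneq => [->|_].
    rewrite !inE => /orP[/eqP->|/H1->]; first by rewrite cb eqxx.
    by rewrite orbT.
  by move=> /H1 ->; rewrite orbT.
move=> d e a' de a'T.
have [nd Td] : (d != b) /\ put a b T d = T d.
  suff nd : d != b by rewrite putE (negbTE nd).
  apply/eqP => E; rewrite E in de; have := addable_hi ok de; rewrite inE negbK.
  move/eqP=> Te; move: a'T; rewrite putE.
  by rewrite eq_sym (negbTE (neq _ _ de)) Te inE.
rewrite Td; move: a'T; rewrite putE; case: eqVneq => [E|_]; last exact: H2.
rewrite E in de *; rewrite !inE => /orP[/eqP->|]; last exact: H2.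
by split => [|a'' /H1/s_lt]; rewrite ?cb //; have := addable_lo ok de; rewrite inE.
Qed.

(** Here [hop] is [f + x a *: add_box c f]: its terms count the fillings without and with the pair
    [(a, c)]. *)
Lemma partition_sum_rcons (f : V) :
  \sum_(T | valid (rcons s (a, c)) T) weight T * f (occupied T) =
  \sum_(T | valid s T)
     weight T * hop (fun c => add_box (D:=D) c) c 1 (1 + x a) f (occupied T).
Proof.
rewrite (bigID (fun T : filling => [exists b, (content (val b) == c) && (a \in T b)])).
rewrite /= addrC (eq_bigl _ _ valid_unused).
have -> : \sum_(T | valid (rcons s (a, c)) T &&
      [exists b, (content (val b) == c) && (a \in T b)])
        weight T * f (occupied T)
   = \sum_(T | valid s T)
      \sum_(b | (content (val b) == c) && addable (occupied T) b)
        x a * weight T * f (b |: occupied T).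
  (* At most one box of content [c] holds [a], so the existence condition can be replaced by a sum
     over boxes. *)
  transitivity (\sum_(T | valid (rcons s (a, c)) T)
     \sum_(b | (content (val b) == c) && (a \in T b)) weight T * f (occupied T)).
    rewrite big_mkcondr; apply: eq_bigr => T vT; case: ifPn.
      case/existsP => b /andP[/eqP cb aT].
      rewrite (big_pred1 b) // => d; apply/andP/eqP => [[/eqP cd aTd]|->].
        exact: (valid_uniq vT).
      by rewrite cb eqxx.
    by move=> /existsPn nob; rewrite big_pred0 // => b; apply/negbTE.
  rewrite (exchange_big_dep (fun b => content (val b) == c)) /=; last first.
    by move=> T b _ /andP[].
  rewrite [RHS](exchange_big_dep (fun b => content (val b) == c)) /=; last first.
    by move=> T b _ /andP[].
  apply: eq_bigr => b /eqP cb.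
  rewrite (reindex_onto (put a b) (cut a b)) /=; last first.
    by move=> T /andP[_ /andP[_]]; exact: cutK.
  apply: eq_big => [T|T].
    by rewrite putK cb eqxx /= -andbA valid_put.
  by rewrite putK occupied_put => /andP[_ aT]; rewrite weight_put.
rewrite -big_split; apply: eq_bigr => T vT /=.
rewrite !ffunE !regularZ mul1r (addrC 1) addrK mulrDr; congr (_ + _).
rewrite mulrCA mulrA mulr_sumr.
by apply: eq_bigr => b _.
Qed.

End LastStep.

Lemma partition_sum s (f : V) : pairwise lt s ->
  \sum_(T | valid s T) weight T * f (occupied T) =
  foldr (fun z => hop (fun c => add_box (D:=D) c) z.2 1 (1 + x z.1)) f s
    finset.set0.
Proof.
elim/last_ind: s f => [|s [a c] IH] f.
  move=> _; rewrite /= (big_pred1 [ffun=> finset.set0]) => [|T].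
    rewrite /weight big1 => [|b _]; last by rewrite ffunE big_set0.
    by rewrite mul1r; congr (f _); apply/setP => b; rewrite !inE ffunE eqxx.
  apply/validP/eqP => [[H1 _]|->]; last by split=> [b a|b d a']; rewrite !ffunE inE.
  apply/ffunP => b; rewrite ffunE; apply/eqP; apply: contraT => /set0Pn[a].
  by move/H1.
rewrite pairwise_rcons => /andP[/allP s_lt ps].
by rewrite partition_sum_rcons // IH // foldr_rcons.
Qed.

End PartitionSum.

(** * The word of a finite alphabet *)

(** For GQ the primed and unprimed copies of a letter at content 0 are consecutive in the word; this
    merges them into one boundary factor. *)
Lemma hop_merge (R : comNzRingType) (S : finType)
    (u : nat -> {linear {ffun S -> R^o} -> {ffun S -> R^o}}) i X Y v :
  (forall w, u i (u i w) = u i w) ->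
  hop u i 1 X (hop u i 1 Y v) = hop u i 1 (X * Y) v.
Proof.
move=> ui; rewrite /hop !linearD !linearZ /= ui.
by apply/ffunP => s; rewrite !ffunE !regularZ; ring.
Qed.

Definition code (a : nat * bool) : nat := a.1.*2 + a.2.

(** In a semistandard tableau, neighbouring boxes sharing an unprimed letter lie in one row, where
    the content grows; those sharing a primed letter lie in one column, where it falls. *)
Definition place_lt (z z' : (nat * bool) * nat) : bool :=
  (code z.1 < code z'.1)%N ||
  (code z.1 == code z'.1) && (if z.1.2 then z.2 < z'.2 else z'.2 < z.2)%N.

Lemma place_lt_irr : irreflexive place_lt.
Proof. by move=> z; rewrite /place_lt; case: ifP; lia. Qed.

Lemma place_lt_trans : transitive place_lt.
Proof.
move=> [[k p] c] [[k' p'] c'] [[k'' p''] c'']; rewrite /place_lt /code /=.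
by case: p p' p'' => [] [] []; lia.
Qed.

Section Word.
(* [gp] is [true] for GP, where primed letters are excluded from content 0, and
   [false] for GQ. *)
Variables (gp : bool) (n N : nat).
Local Notation A := ('I_n * bool)%type.

Definition plain (a : A) : nat * bool := (val a.1, a.2).

Definition word_lt : rel (A * nat) :=
  fun z z' => place_lt (plain z.1, z.2) (plain z'.1, z'.2).

(** All pairs of index [k] in increasing order. Read as a number, [gp] is the least content allowed
    for primed letters. *)
Definition block (k : 'I_n) : seq (A * nat) :=
  [seq ((k, false), c) | c <- rev (iota gp (N.+1 - gp))] ++
  [seq ((k, true), c) | c <- iota 0 N.+1].

Definition word : seq (A * nat) := flatten [seq block k | k <- enum 'I_n].

Lemma mem_block k k' p c : (((k', p), c) \in block k) =
  [&& k' == k, c <= N & p || (gp <= c)]%N.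
Proof.
rewrite mem_cat; apply/orP/and3P => [[]|[/eqP-> cN H]].
- move=> /mapP[c']; rewrite mem_rev mem_iota => cP [-> -> ->].
  by rewrite eqxx; split => //=; lia.
- move=> /mapP[c']; rewrite mem_iota => cP [-> -> ->].
  by rewrite eqxx; split => //; lia.
case: p H => H; [right|left]; apply/mapP; exists c => //.
  by rewrite mem_iota; lia.
by rewrite mem_rev mem_iota; move: H => /=; lia.
Qed.

Lemma mem_word a c : ((a, c) \in word) = (c <= N)%N && (a.2 || (gp <= c)%N).
Proof.
case: a => k p; apply/flatten_mapP/idP => [[k' _]|H].
  by rewrite mem_block => /andP[].
by exists k; rewrite ?mem_enum // mem_block eqxx.
Qed.

Lemma pairwise_word : pairwise word_lt word.
Proof.
have block_pw k : pairwise word_lt (block k).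
  rewrite pairwise_cat !pairwise_map; apply/and3P; split.
  - apply/allrelP => z z' /mapP[c _ ->] /mapP[c' _ ->].
    by rewrite /word_lt /place_lt /code /=; lia.
  - rewrite -sorted_pairwise; last first.
      by move=> c c' c''; exact: place_lt_trans.
    rewrite rev_sorted; apply: sub_sorted (iota_ltn_sorted _ _) => c c'.
    by rewrite /= /word_lt /place_lt /code /=; lia.
  - rewrite -sorted_pairwise; last first.
      by move=> c c' c''; exact: place_lt_trans.
    apply: sub_sorted (iota_ltn_sorted _ _) => c c'.
    by rewrite /= /word_lt /place_lt /code /=; lia.
have : pairwise (fun k k' : 'I_n => k < k')%N (enum 'I_n).
  rewrite -(@pairwise_map _ _ val ltn) val_enum_ord.
  by rewrite -sorted_pairwise ?iota_ltn_sorted //; exact: ltn_trans.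
rewrite /word; elim: (enum 'I_n) => [//|k ks IH] /= /andP[/allP kks /IH pw].
rewrite pairwise_cat block_pw pw !andbT; apply/allrelP => [[[k1 p] c] [[k2 p'] c']].
rewrite mem_block => /andP[/eqP zk _] /flatten_mapP[k' /kks kk'].
rewrite mem_block => /andP[/eqP zk' _].
by rewrite /word_lt /place_lt /code /= zk zk'; lia.
Qed.

(** * The product of operators along the word *)

Section Fold.
Variables (R : comNzRingType) (S : finType).
Local Notation V := {ffun S -> R^o}.
Variables (u : nat -> {linear V -> V}) (y : nat -> R).
Hypothesis u_idem : forall i v, u i (u i v) = u i v.

Definition boundary (X : R) : R := if gp then X else X * X.

(** Raising [N] by one adds a primed pair in front of the block and an unprimed pair at its end,
    just as [kop] recurses. *)
Lemma foldr_block k f :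
  foldr (fun z => hop u z.2 1 (1 + y (val z.1.1))) f (block k) =
  kop u boundary N (1 + y (val k)) f.
Proof.
rewrite /block /boundary; elim: N f => [|M IH] f.
  by case: gp => //=; rewrite hop_merge.
have iotaS m k' : iota m k'.+1 = rcons (iota m k') (m + k')%N.
  by rewrite -addn1 iotaD cats1.
have gpM : (gp <= M.+1)%N by case: gp.
rewrite subSn // !iotaS subnKC // add0n rev_rcons /=.
rewrite map_rcons -rcons_cat foldr_rcons -/(block _) /=; congr hop.
by rewrite iotaS in IH; exact: IH.
Qed.

Lemma foldr_word f :
  foldr (fun z => hop u z.2 1 (1 + y (val z.1.1))) f word =
  foldr (fun k => kop u boundary N (1 + y k)) f (iota 0 n).
Proof.
rewrite -val_enum_ord /word; elim: (enum 'I_n) f => [//|k ks IH] f.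
by rewrite /= foldr_cat foldr_block IH.
Qed.
End Fold.
Arguments boundary {R} X.

(** * Symmetry of the generating function in finitely many variables *)

Section TableauSum.
Variables (R : comNzRingType) (D : {fset nat * nat}).
Hypothesis D_convex : shifted_convex D.
Hypothesis D_bound : forall b, b \in D -> (content b <= N)%N.

Definition tab_sum (y : nat -> R) : R :=
  \sum_(T : {ffun D -> {set A}} | valid word_lt word T &&
      (occupied T == [set: D])) weight (fun a : A => y (val a.1)) T.

Lemma tab_sumE y :
  tab_sum y = foldr
    (fun k => kop (fun c => add_box (D:=D) c) boundary N (1 + y k))
    [ffun I => (I == [set: D])%:R] (iota 0 n) finset.set0.
Proof.
rewrite -foldr_word; last exact: add_box_idem.
have lt_trans : transitive word_lt by move=> z z' z''; apply: place_lt_trans.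
have lt_irr : irreflexive word_lt by move=> z; apply: place_lt_irr.
apply: etrans (partition_sum D_convex (fun a : A => y (val a.1)) lt_irr
  lt_trans _ pairwise_word).
rewrite /tab_sum [LHS]big_mkcondr; apply: eq_bigr => T _.
by rewrite ffunE; case: eqP => _; rewrite ?mulr1 ?mulr0.
Qed.

Lemma boundary_rel (X Y : R) :
  (X * Y - 1) * X * (boundary X - boundary Y) =
  (X - Y) * ((boundary X - 1) * X * Y + (boundary Y - 1) * boundary X).
Proof. by rewrite /boundary; case: gp; ring. Qed.

(** The swap transposes two neighbouring [kop] factors of the product in [tab_sumE], and these
    commute. *)
Lemma tab_sum_swap y i : (i.+1 < n)%N ->
  (forall a, (1 + y i) * a = 0 -> a = 0) ->
  tab_sum (y \o swap_index i) = tab_sum y.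
Proof.
move=> i_n reg; rewrite !tab_sumE /=.
set K := fun k => kop _ _ N (1 + y k).
rewrite -[foldr _ _ _ in LHS](foldr_map (swap_index i) K).
have -> : iota 0 n = iota 0 i ++ i :: i.+1 :: iota i.+2 (n - i.+2).
  have {1}-> : n = (i + (n - i.+2).+2)%N by lia.
  by rewrite iotaD.
have -> : [seq swap_index i j | j <- iota 0 i ++ i :: i.+1 :: iota i.+2 (n - i.+2)]
    = iota 0 i ++ i.+1 :: i :: iota i.+2 (n - i.+2).
  rewrite map_cat !map_cons.
  have swap_id s : {in s, forall j, j != i /\ j != i.+1} ->
      [seq swap_index i j | j <- s] = s.
    move=> sP; apply: map_id_in => j /sP[/negbTE ji /negbTE jSi].
    by rewrite /swap_index ji jSi.
  rewrite !swap_id => [|j|j]; rewrite ?mem_iota; try by lia.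
  by rewrite /swap_index !eqxx gtn_eqF.
rewrite !foldr_cat; congr (foldr K _ _ _); rewrite /=.
rewrite /K [RHS](kop_comm _ _ _ _ boundary_rel); first by [].
- exact: add_box_idem.
- by move=> *; apply: add_box_comm.
- exact: add_box_up.
- exact: add_box_down.
(* No box has content [N.+1], so its operator is zero. *)
- move=> f; apply/ffunP => I; rewrite !ffunE big_pred0 // => b.
  apply/negP => /andP[/eqP cb _]; have := D_bound (valP b).
  by rewrite /= in cb *; rewrite cb ltnn.
exact: reg.
Qed.
End TableauSum.
End Word.

(** * Tableaux *)

Import all_classical.

(** Row [i] of the shifted diagram ends just before column [nth 0 s i + i]; strictness makes these
    ends weakly decrease over nonempty rows. *)
Lemma strict_nth_shift s i j : sorted gtn s -> (i <= j)%N ->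
  (0 < nth 0%N s j)%N -> (nth 0%N s j + j <= nth 0%N s i + i)%N.
Proof.
move=> s_sorted; elim: j => [|j IH]; first by rewrite leqn0 => /eqP->.
rewrite leq_eqVlt => /orP[/eqP->//|ij] s_gt0.
have j_lt : (j.+1 < size s)%N.
  by rewrite ltnNge; apply/negP => sj; rewrite nth_default in s_gt0.
have sj : (nth 0%N s j.+1 < nth 0%N s j)%N.
  by have /(sortedP 0%N)/(_ j j_lt) := s_sorted.
by have := IH ij (leq_ltn_trans (leq0n _) sj); lia.
Qed.

(** The bound by [la] is inherited from the larger box and the bound by [mu] from the smaller one;
    the latter is trivial where [mu] has no part. *)
Lemma SD_shifted_convex mu la :
  sorted gtn mu -> sorted gtn la -> shifted_convex (SD la mu).
Proof.
move=> mu_s la_s; split=> [[i c]|]; first by rewrite in_SD => /andP[].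
move=> [r c] [i k] [r' c']; rewrite !in_SD /below /=.
move=> /andP[rc /andP[m1 l1]] /andP[rc' /andP[m2 l2]] ik bd de.
have := @strict_nth_shift la i r' la_s; have := @strict_nth_shift mu r i mu_s.
lia.
Qed.

Lemma leq_letter (a b : letter) : (a <= b)%O = (code a <= code b)%N.
Proof.
rewrite Order.ProdLexiOrder.leEprodlexi /code.
case: a b => [i p] [j q]; rewrite !leEnat /= leEbool.
by case: p q => [] [] /=; lia.
Qed.

Lemma code_inj : injective code.
Proof.
move=> [i p] [j q]; rewrite /code /= => E.
have -> : i = j by case: p q E => [] []; lia.
by congr pair; case: p q E => [] [] //; lia.
Qed.

(** * Swapping variables in monomials *)

Lemma swap_monomK i : involutive (swap_monom i).
Proof. by move=> m; apply/eqP/cmP => j; rewrite !swap_monomE swap_indexK. Qed.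

Lemma swap_monomM i : {morph swap_monom i : m m' / mmul m m'}.
Proof. by move=> m m'; apply/eqP/cmP => j; rewrite !(swap_monomE, cmM). Qed.

Lemma swap_monom1 i : swap_monom i mone = mone.
Proof. by apply/eqP/cmP => j; rewrite swap_monomE !cm1. Qed.

Lemma swap_monomU i k : swap_monom i (ucm k) = ucm (swap_index i k).
Proof.
apply/eqP/cmP => j; rewrite swap_monomE !cmU.
by rewrite -(inj_eq (can_inj (@swap_indexK i))) swap_indexK.
Qed.

Lemma mdeg_swap_monom i m : mdeg (swap_monom i m) = mdeg m.
Proof.
rewrite !mdegE; have -> : finsupp (swap_monom i m) = (swap_index i @` finsupp m)%fset.
  apply/fsetP => j; rewrite -cmE_neq0 swap_monomE cmE_neq0.
  apply/idP/imfsetP => [jm|[k km ->]]; last by rewrite swap_indexK.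
  by exists (swap_index i j); rewrite ?swap_indexK.
rewrite big_imfset /=; last by move=> j k _ _; exact: (can_inj (@swap_indexK i)).
by apply: eq_bigr => j _; rewrite swap_monomE swap_indexK.
Qed.

Lemma tsizeE la mu (T : tableau la mu) : Defs.tsize T = mdeg (x_tab T).
Proof.
rewrite /Defs.tsize /x_tab mdeg_prod; apply: eq_bigr => b _.
rewrite /x_set mdeg_prod -sum1_size; apply: eq_bigr => a _.
by rewrite mdegU.
Qed.

Lemma malgUM : {morph (fun m => << m >> : {malg int[{cmonom nat}]}) :
  m m' / mmul m m' >-> m * m'}.
Proof. by move=> m m'; rewrite malgM_def fgmulUU mulr1. Qed.

(** The coefficient of [f] at [m] is minus its coefficient at [m] divided by the variable, or zero
    if that is impossible; induction on the exponent of the variable. *)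
Lemma malg1U_reg i (f : {malg int[{cmonom nat}]}) :
  (1 + << ucm i >>) * f = 0 -> f = 0.
Proof.
have split1 x : (1 + x) * f = f + x * f by rewrite mulrDl mul1r.
rewrite {}split1 => f0; apply/malgP => m; rewrite mcoeff0.
have [k] := ubnP (m i); elim: k m => // k IH m; rewrite ltnS => mk.
move: f0 => /(congr1 (mcoeff m)).
rewrite mcoeffD mcoeff0 malgM_def fgmulUg raddf_sum /= big1 ?addr0 // => m' _.
rewrite mcoeffU; case: eqP => // E; rewrite mul1r IH ?mul0rn //.
by rewrite (leq_trans _ mk) // -E cmM cmU eqxx.
Qed.

(** * Tableaux as fillings over a finite alphabet *)

Section Encoding.
Variables (mu la : seq nat) (n : nat).
Local Notation D := (SD la mu).
Local Notation A := ('I_n * bool)%type.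
Local Notation filling := {ffun D -> {set A}}.

Lemma plain_inj : injective (@plain n).
Proof. by move=> [i p] [j q] [/val_inj -> ->]. Qed.

Definition decode (T : filling) : tableau la mu :=
  [ffun b => seq_fset tt [seq (plain a : letter) | a <- enum (T b)]].

Lemma mem_decode (T : filling) b a :
  ((plain a : letter) \in decode T b) = (a \in T b).
Proof. by rewrite ffunE seq_fsetE mem_map ?mem_enum //; exact: plain_inj. Qed.

Lemma decodeP (T : filling) b (l : letter) :
  reflect (exists2 a, a \in T b & l = plain a) (l \in decode T b).
Proof.
rewrite ffunE seq_fsetE; apply: (iffP mapP) => -[a aT ->].
  by exists a => //; rewrite mem_enum in aT.
by exists a => //; rewrite mem_enum.
Qed.

Lemma decode_inj : injective decode.
Proof.
move=> T T' E; apply/ffunP => b; apply/setP => a.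
by rewrite -!mem_decode E.
Qed.

Lemma x_tab_decode (T : filling) :
  x_tab (decode T) =
    (\big[mmul/mone]_b \big[mmul/mone]_(a in T b) ucm (val a.1))%M.
Proof.
apply: eq_bigr => b _; rewrite /x_set ffunE.
rewrite (perm_big [seq (plain a : letter) | a <- enum (T b)]) /=.
  by rewrite big_map big_enum.
apply: uniq_perm; first exact: sort_keys_uniq.
  by rewrite map_inj_uniq ?enum_uniq //; exact: plain_inj.
by move=> l; rewrite sort_keysE.
Qed.

Hypothesis D_convex : shifted_convex D.

(** The neighbour conditions are chained along the path from [b] to [d] that goes right, then down.
    Convexity keeps it inside the diagram, and each intermediate box supplies a letter. *)
Lemma semistandard_place_lt T (b d : D) (a a' : letter) :
    semistandard T -> below (val b) (val d) -> a \in T b -> a' \in T d ->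
  place_lt (a, content (val b)) (a', content (val d)).
Proof.
move=> [T_ne T_row T_col T_unprimed T_primed].
have [m] := ubnP ((val d).1 + (val d).2 - ((val b).1 + (val b).2))%N.
elim: m => // m IH in b a *; rewrite ltnS => le_m bd aT a'T.
have bdiag := diag_le D_convex b; have ddiag := diag_le D_convex d.
pose e := if ((val b).2 < (val d).2)%N then ((val b).1, (val b).2.+1)
          else ((val b).1.+1, (val b).2).
have be : below (val b) e by rewrite /e /below; case: ifP => /=; lia.
have ed : e = val d \/ below e (val d).
  move: bd bdiag ddiag; rewrite /e /below.
  case: (val b) (val d) => [b1 b2] [d1 d2] /=; case: ifP => /= cmp bd bdiag ddiag.
    have [E|E] : (b1 = d1 /\ b2.+1 = d2) \/ (b1 + b2.+1 < d1 + d2)%N by lia.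
      by case: E => -> ->; left.
    by right; lia.
  have [E|E] : (b1.+1 = d1 /\ b2 = d2) \/ (b1.+1 + b2 < d1 + d2)%N by lia.
    by case: E => -> ->; left.
  by right; lia.
have eD : e \in D.
  case: ed => [->|ed]; first exact: valP.
  case: D_convex => _ conv; apply: conv (valP b) (valP d) _ be ed.
  by move: bd bdiag ddiag; rewrite /e /below; case: ifP => /=; lia.
have [e' eE] : exists e' : D, val e' = e by exists [` eD]%fset.
have adjacent a1 : a1 \in T e' ->
    place_lt (a, content (val b)) (a1, content (val e')).
  have neq : b != e'.
    by apply/eqP => E; move: be; rewrite -eE E belowxx.
  move=> a1T; move: eE; rewrite /e; case: ifP => cmp eE.
    have := T_row _ _ eE _ _ aT a1T; rewrite leq_letter leq_eqVlt.
    case/orP => [/eqP/code_inj E|lt_a]; last by rewrite /place_lt lt_a.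
    (* A letter repeated along a row is unprimed, and the content increases. *)
    subst a1; have /negbNE unp : ~~ primed a.
      apply/negP => pa; have := T_primed _ _ a neq _ pa aT.
      by rewrite eE a1T => /(_ erefl).
    rewrite /place_lt /= unp eqxx eE /content.
    by move: bdiag; clear=> /=; lia.
  have := T_col _ _ eE _ _ aT a1T; rewrite leq_letter leq_eqVlt.
  case/orP => [/eqP/code_inj E|lt_a]; last by rewrite /place_lt lt_a.
  (* A letter repeated down a column is primed, and the content decreases. *)
  subst a1; have unp : primed a.
    apply: contraT => pa; have := T_unprimed _ _ a neq _ pa aT.
    by rewrite eE a1T => /(_ erefl).
  rewrite /place_lt /= (negbTE unp) eqxx eE /content.
  by move: cmp bd bdiag ddiag; rewrite /below; clear=> /=; lia.
rewrite -eE in be ed; case: ed => [E|ed].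
  have E' : e' = d by exact: val_inj.
  by rewrite -E'; apply: adjacent; rewrite E'.
have /fset0Pn[a1 a1T] := T_ne e'.
apply: place_lt_trans (adjacent _ a1T) (IH e' _ _ ed a1T a'T).
by move: be bd le_m; rewrite /below /=; lia.
Qed.

Variables (gp : bool) (N : nat).
Hypothesis D_bound : forall b, b \in D -> (content b <= N)%N.

Definition admissible (T : tableau la mu) : Prop :=
  semistandard T /\ (gp -> diag_unprimed T).

Definition full_valid (T : filling) : bool :=
  valid (@word_lt n) (word gp n N) T && (occupied T == [set: D]%SET).

Lemma decode_neq0 (T : filling) b :
  (decode T b != fset0) = (T b != finset.set0).
Proof.
apply/fset0Pn/set0Pn => [[l /decodeP[a aT _]]|[a aT]]; first by exists a.
by exists (plain a : letter); rewrite mem_decode.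
Qed.

Lemma full_valid_admissible T : full_valid T -> admissible (decode T).
Proof.
case/andP=> /validP[T_word T_lt] /eqP occT.
have T_neq0 b : decode T b != fset0.
  by rewrite decode_neq0; have := finset.in_setT b; rewrite -occT inE.
have lt_T (b d : D) l l' : below (val b) (val d) ->
    l \in decode T b -> l' \in decode T d ->
    place_lt (l, content (val b)) (l', content (val d)).
  move=> bd /decodeP[a aT ->] /decodeP[a' a'T ->].
  by have [_ /(_ a aT)] := T_lt b d a' bd a'T.
have le_T (b d : D) l l' : below (val b) (val d) ->
    l \in decode T b -> l' \in decode T d -> (l <= l')%O.
  move=> bd lT l'T; have := lt_T b d l l' bd lT l'T.
  by rewrite leq_letter /place_lt /=; lia.
have col_T (b d : D) l : ((val b).1 < (val d).1)%N -> (val b).2 = (val d).2 ->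
    ~~ primed l -> l \in decode T b -> l \in decode T d -> False.
  move=> bd1 bd2 /negbNE pl lb ld.
  have bd : below (val b) (val d) by move: bd1 bd2; rewrite /below /=; lia.
  have := lt_T b d l l bd lb ld; have := diag_le D_convex d.
  rewrite /place_lt /= pl ltnn eqxx /content.
  by move: bd1 bd2 => /=; lia.
have row_T (b d : D) l : ((val b).2 < (val d).2)%N -> (val b).1 = (val d).1 ->
    primed l -> l \in decode T b -> l \in decode T d -> False.
  move=> bd2 bd1 pl lb ld.
  have bd : below (val b) (val d) by move: bd1 bd2; rewrite /below /=; lia.
  have := lt_T b d l l bd lb ld; have := diag_le D_convex b.
  rewrite /place_lt /= (negbTE pl) ltnn eqxx /content.
  by move: bd1 bd2 => /=; lia.
split; first split => //.
- by move=> b d E l l'; apply: le_T; rewrite E /below /=; lia.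
- by move=> b d E l l'; apply: le_T; rewrite E /below /=; lia.
- move=> b d l bd E pl lb; apply/negP => ld.
  have : (val b).1 != (val d).1.
    by apply: contra bd => /eqP E1; apply/eqP/val_inj/injective_projections.
  by rewrite neq_ltn => /orP[] lt; [apply: (col_T b d l)|apply: (col_T d b l)].
- move=> b d l bd E pl lb; apply/negP => ld.
  have : (val b).2 != (val d).2.
    by apply: contra bd => /eqP E1; apply/eqP/val_inj/injective_projections.
  by rewrite neq_ltn => /orP[] lt; [apply: (row_T b d l)|apply: (row_T d b l)].
move=> gpT b E l /decodeP[a /T_word + ->]; rewrite mem_word /content E subnn gpT.
by rewrite /primed negbK /= orbF.
Qed.

Lemma admissible_full_valid T : admissible (decode T) -> full_valid T.
Proof.
move=> [ssT dT]; have T_neq0 b : T b != finset.set0.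
  by rewrite -decode_neq0; case: ssT.
apply/andP; split; last by apply/eqP/setP => b; rewrite !inE T_neq0.
apply/validP; split=> [b a aT|b d a' bd a'T].
  rewrite mem_word (D_bound (valP b)) /=; apply/orP.
  case: (boolP a.2) => a2; [by left|right].
  (* A positive content is at least [gp] in either case; content 0 means a diagonal box, where GP
     forbids primed letters. *)
  case: (posnP (content (val b))) => [c0|]; last by case: gp.
  case E : gp => //; have b_diag : (val b).1 = (val b).2.
    by move: c0 (diag_le D_convex b); rewrite /content /=; lia.
  have := dT E b b_diag (plain a); rewrite mem_decode => /(_ aT).
  by rewrite /primed negbK /= (negbTE a2).
split=> // a aT; apply: (semistandard_place_lt ssT bd); by rewrite mem_decode.
Qed.

Definition encode (T : tableau la mu) : filling :=
  [ffun b => [set a : A | (plain a : letter) \in T b]%SET].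

Lemma encodeK (T : tableau la mu) : (forall b l, l \in T b -> (l.1 < n)%N) ->
  decode (encode T) = T.
Proof.
move=> T_lt; apply/ffunP => b; apply/fsetP => l.
apply/decodeP/idP => [[a + ->]|lT]; first by rewrite ffunE inE.
have ln := T_lt b l lT; exists (Ordinal ln, l.2); last exact: surjective_pairing.
by rewrite ffunE inE /plain -surjective_pairing.
Qed.

Definition count (m : {cmonom nat}) : nat :=
  #|[pred T : filling | full_valid T && (x_tab (decode T) == m)]|.

(** The monomials [g k] are general so as to cover both the variables and their swapped images. *)
Lemma tab_sum_coeff (g : nat -> {cmonom nat}) m :
  (tab_sum gp n N D (fun k => << g k >> : {malg int[{cmonom nat}]}))@_m =
  #|[pred T : filling | full_valid T &&
      ((\big[mmul/mone]_b \big[mmul/mone]_(a in T b) g (val a.1))%M == m)]|%:R.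
Proof.
rewrite /tab_sum raddf_sum /= -sum1_card natr_sum [RHS]big_mkcondr /=.
apply: eq_bigr => T _.
have -> : weight (fun a : A => << g (val a.1) >>) T =
    << (\big[mmul/mone]_b \big[mmul/mone]_(a in T b) g (val a.1))%M >>
      :> {malg int[{cmonom nat}]}.
  rewrite (big_morph _ malgUM (erefl _)); apply: eq_bigr => b _.
  by rewrite (big_morph _ malgUM (erefl _)).
by rewrite mcoeffU1; case: eqP.
Qed.

(** Symmetry of [tab_sum] replaces the variables by their swapped images at the coefficient of
    [swap_monom i m]; injectivity of the swap then removes it from both sides. *)
Lemma count_swap i m : (i.+1 < n)%N -> count (swap_monom i m) = count m.
Proof.
move=> i_n; apply/eqP; rewrite -(Num.Theory.eqr_nat int); apply/eqP.
transitivity ((tab_sum gp n N D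
  (fun k => << ucm k >> : {malg int[{cmonom nat}]}))@_(swap_monom i m)).
  rewrite tab_sum_coeff; congr _%:R; apply: eq_card => T.
  by rewrite !inE x_tab_decode.
rewrite -(tab_sum_swap gp D_convex D_bound i_n) /=; last exact: malg1U_reg.
rewrite tab_sum_coeff; congr _%:R; apply: eq_card => T.
rewrite !inE -(inj_eq (can_inj (@swap_monomK i))) x_tab_decode; congr (_ && (_ == _)).
rewrite (big_morph _ (@swap_monomM i) (@swap_monom1 i)); apply: eq_bigr => b _.
rewrite (big_morph _ (@swap_monomM i) (@swap_monom1 i)); apply: eq_bigr => a _.
by rewrite swap_monomU.
Qed.

Lemma tab_series_count (m : {cmonom nat}) :
    (forall j, j \in finsupp m -> j < n)%N ->
  tab_series [set T : tableau la mu | admissible T] m =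
  ('X^(mdeg m - (sumn la - sumn mu)) *+ count m)%R.
Proof.
move=> m_lt; rewrite /tab_series.
rewrite (@reindex_fsbig _ _ _ _ _ decode
  [set` [pred T : filling | full_valid T && (x_tab (decode T) == m)]]).
  rewrite -(bigfs _ (index_enum_uniq (filling : finType))); last first.
    by move=> T _; rewrite mem_index_enum.
  rewrite -sumr_const; apply: eq_bigr => T /andP[_ /eqP xT].
  by rewrite tsizeE xT.
split.
- by move=> T /= /andP[/full_valid_admissible vT /eqP].
- by move=> T T' _ _ /decode_inj.
(* Every letter of [T] contributes its variable to [m], so [T] uses only the first [n] indices and
   can be encoded. *)
move=> T /= [aT xT]; have T_lt b l : l \in T b -> (l.1 < n)%N.
  move=> lT; apply: m_lt; rewrite -cmE_neq0 -xT /x_tab (bigD1 b) //= cmM.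
  by rewrite /x_set (big_fsetD1 l) //= cmM cmU eqxx.
have TK := encodeK T_lt; exists (encode T) => //=.
by rewrite inE TK xT eqxx andbT; apply: admissible_full_valid; rewrite TK.
Qed.

End Encoding.

Lemma tab_series_sym mu la gp : sorted gtn mu -> sorted gtn la ->
  mSym (tab_series [set T : tableau la mu | admissible gp T]).
Proof.
move=> mu_s la_s i m; have D_convex := SD_shifted_convex mu_s la_s.
(* Large enough for both [m] and [swap_monom i m], and for the variables [i] and [i.+1]. *)
pose n := maxn i.+2 (\max_(j <- finsupp m) j.+2).
pose N := \max_(b <- SD la mu) content b.
have D_bound b : b \in SD la mu -> (content b <= N)%N.
  by move=> bD; apply: (@leq_bigmax_seq _ _ _ content).
have m_lt j : j \in finsupp m -> (j.+1 < n)%N.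
  move=> jm; rewrite leq_max; apply/orP; right.
  by apply: (@leq_bigmax_seq _ _ _ (fun j => j.+2)).
have i_lt : (i.+1 < n)%N by rewrite leq_max leqnn.
rewrite (@tab_series_count _ _ n D_convex gp N D_bound); last first.
  move=> j; rewrite -cmE_neq0 swap_monomE cmE_neq0 => /m_lt.
  by rewrite /swap_index; case: eqP => [->|_]; [|case: eqP => [->|_]]; lia.
rewrite (@tab_series_count _ _ n D_convex gp N D_bound); last first.
  by move=> j /m_lt; lia.
by rewrite mdeg_swap_monom count_swap.
Qed.

Theorem theorem5p5 (mu la : seq nat) :
  strict_partition mu -> strict_partition la -> subpart mu la ->
  mSym (GP la mu) /\ mSym (GQ la mu).
Proof.
move=> /andP[mu_s _] /andP[la_s _] _; split.
  have := tab_series_sym true mu_s la_s; rewrite /GP.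
  congr (mSym (tab_series _)); apply/seteqP.
  by split=> T [ssT dT]; split => //; apply: dT.
have := tab_series_sym false mu_s la_s; rewrite /GQ.
congr (mSym (tab_series _)); apply/seteqP.
by split=> [T []|T ssT].
Qed.
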